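(* Let $k\ge 1$ be an integer and let $\Pi^{(k)}$ be the set of $(k+1)$-nonnesting open partition diagrams. To each $\pi\in\Pi^{(k)}$ associate the label $\ell(\pi)=[s_0,\dots,s_{k-1}]$, where $s_i$ is the number of semi-arcs of $\pi$ with nesting index $\ge i$. Consider the generating tree with root label $[0,0,\dots,0]$ and succession rule sending $[s_0,s_1,\dots,s_{k-1}]$ to the following labels: (1) $[s_0,s_1,\dots,s_{k-1}]$; (2) $[s_0+1,s_1,\dots,s_{k-1}]$; (3) $[s_0,s_1-1,\dots,s_{j-1}-1,i,s_{j+1},\dots,s_{k-1}]$ for each $1\le j\le k-1$ and each $i$ with $s_j\le i\le s_{j-1}-1$; (4) $[s_0-1,s_1-1,\dots,s_{j-1}-1,i,s_{j+1},\dots,s_{k-1}]$ for each $1\le j\le k-1$ and each $i$ with $s_j\le i\le s_{j-1}-1$; (5) $[s_0,s_1-1,\dots,s_{k-1}-1]$ and $[s_0-1,s_1-1,\dots,s_{k-1}-1]$, if $s_{k-1}>0$. Then for every $n\ge 0$ the number of diagrams in $\Pi^{(k)}$ of size $n$ equals the number of nodes at level $n$ of this generating tree.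
   Context: An open partition diagram of size $n\ge 0$ consists of vertices $1,\dots,n$ in a row, a set of arcs $(a,b)$ with $1\le a<b\le n$ and a set of semi-arcs $(a,* )$ with $1\le a\le n$ (a semi-arc has a left end-point but no right end-point), such that every vertex is the left end-point of at most one arc or semi-arc and the right end-point of at most one arc. (Equivalently: a set partition of $\{1,\dots,n\}$ with each block marked closed or open; block $\{a_1<\dots<a_r\}$ gives arcs $(a_1,a_2),\dots,(a_{r-1},a_r)$ and, if open, the semi-arc $(a_r,* )$.) A $k$-nesting is a set of $k$ arcs $(i_1,j_1),\dots,(i_k,j_k)$ with $i_1<\dots<i_k<j_k<\dots<j_1$. A future $k$-nesting is a $(k-1)$-nesting $(i_2,j_2),\dots,(i_k,j_k)$ together with a semi-arc $(i_1,* )$ with $i_1<i_2$. An open partition diagram is $k$-nonnesting if it contains neither a $k$-nesting nor a future $k$-nesting. The nesting index of a semi-arc $(a,* )$ is the largest $j\ge0$ such that there is a $j$-nesting all of whose arcs have left end-points greater than $a$ (equivalently, the largest $j$ such that the semi-arc is in a future $(j+1)$-nesting). A generating tree with root label $L_0$ and a succession rule (assigning to each label a finite list of labels, with multiplicity) is the rooted tree whose root, at level $0$, has label $L_0$, and in which each node with label $L$ has one child for each entry of the list assigned to $L$, labelled by that entry; level $n$ consists of the nodes at distance $n$ from the root. *)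

(* Defs.v *)
From HB Require Import structures.
From mathcomp Require Import all_boot.

Set Implicit Arguments.
Unset Strict Implicit.
Unset Printing Implicit Defensive.

(* Vertices 1, ..., n are encoded as the elements 0, ..., n-1 of 'I_n; a
   semi-arc is encoded by its left end-point. *)
Definition is_open_diagram n (d : {set 'I_n * 'I_n} * {set 'I_n}) : bool :=
  [&& [forall e in d.1, e.1 < e.2],
      [forall v, #|[set e in d.1 | e.1 == v]| + (v \in d.2) <= 1]
    & [forall v, #|[set e in d.1 | e.2 == v]| <= 1]].

Record open_diagram n := OpenDiagram {
  diagram_val : {set 'I_n * 'I_n} * {set 'I_n};
  _ : is_open_diagram diagram_val
}.

HB.instance Definition _ n := [isSub for @diagram_val n].
HB.instance Definition _ n := [Finite of open_diagram n by <:].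

Definition arcs n (d : open_diagram n) : {set 'I_n * 'I_n} :=
  (diagram_val d).1.

Definition semiarcs n (d : open_diagram n) : {set 'I_n} :=
  (diagram_val d).2.

(* For t = (i_1, j_1), ..., (i_k, j_k): the sequence
   i_1, ..., i_k, j_k, ..., j_1. *)
Definition endpoints n (t : seq ('I_n * 'I_n)) : seq nat :=
  [seq val e.1 | e <- t] ++ rev [seq val e.2 | e <- t].

(* A nesting is listed from its outermost to its innermost arc. *)
Definition is_nesting n (d : open_diagram n) (t : seq ('I_n * 'I_n)) : bool :=
  all [in arcs d] t && sorted ltn (endpoints t).

Definition has_nesting k n (d : open_diagram n) : bool :=
  [exists t : k.-tuple ('I_n * 'I_n), is_nesting d t].

(* Meaningful for 1 <= k; [path ltn a] puts the left end-point a of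
   the semi-arc before the chain of end-points of the (k-1)-nesting. *)
Definition has_future_nesting k n (d : open_diagram n) : bool :=
  [exists a in semiarcs d, exists t : k.-1.-tuple ('I_n * 'I_n),
     is_nesting d t && path ltn a (endpoints t)].

Definition nonnesting k n (d : open_diagram n) : bool :=
  ~~ has_nesting k d && ~~ has_future_nesting k d.

(* The members of Pi^(k) of size n. *)
Definition Pi k n : {set open_diagram n} :=
  [set d : open_diagram n | nonnesting k.+1 d].

(* The bound j <= n loses nothing: the arcs of a j-nesting have j distinct
   left end-points. *)
Definition nesting_index n (d : open_diagram n) (a : 'I_n) : nat :=
  \max_(j < n.+1 | [exists t : j.-tuple ('I_n * 'I_n),
                      is_nesting d t && all [pred e : 'I_n * 'I_n | a < e.1] t]) j.

(* The statistic that the labels [s_0, ..., s_(k-1)] of the tree record on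
   diagrams; the count of nodes by level does not refer to it. *)
Definition label k n (d : open_diagram n) : seq nat :=
  mkseq (fun i => #|[set a in semiarcs d | i <= nesting_index d a]|) k.

(* The labels of the nodes at level n, one entry per node. *)
Fixpoint tree_level (T : Type) (rule : T -> seq T) (root : T) (n : nat) :
    seq T :=
  if n is m.+1 then flatten (map rule (tree_level rule root m))
  else [:: root].

(* Labels reachable from [0, ..., 0] are weakly decreasing, so every entry
   decremented below is positive and truncated subtraction is harmless.  The
   condition s_j <= i <= s_(j-1) - 1 is read over the integers, as
   s_j <= i < s_(j-1): there is no such i when s_(j-1) = 0. *)
Definition succession_rule k (s : seq nat) : seq (seq nat) :=
  [:: s]
  ++ [:: (nth 0 s 0).+1 :: behead s]
  ++ [seq nth 0 s 0 :: map predn (take j.-1 (behead s)) ++ i :: drop j.+1 s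
        | j <- iota 1 k.-1, i <- index_iota (nth 0 s j) (nth 0 s j.-1)]
  ++ [seq map predn (take j s) ++ i :: drop j.+1 s
        | j <- iota 1 k.-1, i <- index_iota (nth 0 s j) (nth 0 s j.-1)]
  ++ (if 0 < nth 0 s k.-1
      then [:: nth 0 s 0 :: map predn (behead s); map predn s]
      else [::]).

(* Main.v *)
Require Import Defs.
From mathcomp Require Import all_boot zify.

(* A diagram of size n.+1 arises from exactly one diagram of size n by adding a
   last vertex, which closes at most one semi-arc [a] and may open a new one.
   The new arc [(a, n)] is outermost, so it encloses exactly the nestings to the
   right of [a]: the semi-arcs left of [a] get nesting index at least one more
   than that of [a], and nothing else changes.  Nesting indices decrease from
   left to right, so if [p] semi-arcs lie left of [a] and
   [s_j <= p < s_(j-1)], then [a] has index [j-1], the entries before [s_j]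
   drop by one and [s_j] becomes [p]; this is the rule, with [i = p].  When [a]
   has index [k-1] the new diagram stays nonnesting only if [p = 0].  Hence the
   labels of the diagrams of size n are, as a multiset, level n of the tree. *)

Set Implicit Arguments.
Unset Strict Implicit.
Unset Printing Implicit Defensive.

(** * Nestings and nesting indices *)

Section Nesting.
Variables (n : nat) (d : open_diagram n).
Implicit Types (e f : 'I_n * 'I_n) (t : seq ('I_n * 'I_n)).

Lemma is_open_diagramP (D : {set 'I_n * 'I_n} * {set 'I_n}) :
  reflect [/\ forall x y, (x, y) \in D.1 -> x < y,
              forall x y z, (x, y) \in D.1 -> (x, z) \in D.1 -> y = z,
              forall x y z, (x, z) \in D.1 -> (y, z) \in D.1 -> x = y
            & forall x y, (x, y) \in D.1 -> x \notin D.2]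
          (is_open_diagram D).
Proof.
apply: (iffP and3P) => [[/forall_inP lt_D /forallP out_D /forallP in_D]|].
  split=> [x y xyD|x y z xyD xzD|x y z xzD yzD|x y xyD].
  - exact: lt_D xyD.
  - have /card_le1_eqP eqD := leq_trans (leq_addr _ _) (out_D x).
    have [//] : (x, y) = (x, z) by apply: eqD; rewrite inE /= ?xyD ?xzD eqxx.
  - have /card_le1_eqP eqD := in_D z.
    have [//] : (x, z) = (y, z) by apply: eqD; rewrite inE /= ?xzD ?yzD eqxx.
  - apply/negP=> xD; have := out_D x; rewrite xD addn1 ltnS leqn0 cards_eq0.
    by move/eqP/setP/(_ (x, y)); rewrite !inE xyD eqxx.
move=> [lt_D out_D in_D open_D]; split.
  by apply/forall_inP=> -[x y]; apply: lt_D.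
all: apply/forallP.
- move=> x; case: (boolP (x \in D.2)) => xD.
    rewrite addn1 ltnS leqn0 cards_eq0; apply/eqP/setP=> -[y z];
      rewrite !inE /=.
    apply/negP=> /andP[yzD /eqP eq_yx].
    by have := open_D _ _ yzD; rewrite eq_yx xD.
  rewrite addn0; apply/card_le1_eqP=> -[y z] [y' z']; rewrite !inE /=.
  by move=> /andP[D1 /eqP eq1] /andP[D2 /eqP eq2]; subst;
    rewrite (out_D _ _ _ D1 D2).
- move=> x; apply/card_le1_eqP=> -[y z] [y' z']; rewrite !inE /=.
  by move=> /andP[D1 /eqP eq1] /andP[D2 /eqP eq2]; subst;
    rewrite (in_D _ _ _ D1 D2).
Qed.

(** Peeling off the outermost arc gives a recursion on [t]. Comparing left ends with [e.1] and right
    ends with [e.2] suffices, since sortedness of the inner chain puts each left end below its right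
    end. *)
Lemma sorted_endpoints_cons e t :
  sorted ltn (endpoints (e :: t)) =
  [&& e.1 < e.2, all (fun f => (e.1 < f.1) && (f.2 < e.2)) t
    & sorted ltn (endpoints t)].
Proof.
rewrite /endpoints /= rev_cons -rcons_cat rcons_path -/(endpoints t).
rewrite (path_sortedE ltn_trans) -andbA.
apply/and3P/and3P => [[lt_e st lt_last]|[lt_e /allP lt_t st]].
  have st' : path ltn e.1 (endpoints t)
    by rewrite (path_sortedE ltn_trans) lt_e.
  have st2 : path ltn e.1 (rcons (endpoints t) e.2) by rewrite rcons_path st'.
  have : all (ltn^~ e.2) (val e.1 :: endpoints t).
    have : pairwise ltn (rcons (val e.1 :: endpoints t) e.2).
      by rewrite -(sorted_pairwise ltn_trans).
    by rewrite pairwise_rcons => /andP[].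
  move=> /= /andP[lt12 /allP lt2]; split=> //.
  move/allP in lt_e; apply/allP=> f ft; apply/andP; split.
    by apply: lt_e; rewrite mem_cat (map_f (fun e => val e.1)).
  by apply: lt2; rewrite mem_cat mem_rev (map_f (fun e => val e.2)) // orbT.
have lt_t12 f : f \in t -> f.1 < f.2.
  move=> /splitPr st'; move: st; case: st' => t1 t2.
  rewrite /endpoints !map_cat rev_cat /= rev_cons -cats1 !catA.
  rewrite (sorted_pairwise ltn_trans) -!catA pairwise_cat => /and3P[_ _].
  rewrite /= => /andP[/allP + _].
  by apply; rewrite !mem_cat inE eqxx !orbT.
have lt_all x : x \in endpoints t -> e.1 < x < e.2.
  rewrite mem_cat mem_rev => /orP[] /mapP[f ft ->];
    have /andP[lt1 lt2] := lt_t f ft; have lt12 := lt_t12 f ft.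
    by rewrite lt1 (ltn_trans lt12 lt2).
  by rewrite lt2 (ltn_trans lt1 lt12).
split=> //; first by apply/allP=> x /lt_all/andP[].
have := mem_last (val e.1) (endpoints t); rewrite inE => /predU1P[-> //|].
by move=> /lt_all/andP[].
Qed.

Lemma is_nesting_cons e t :
  is_nesting d (e :: t) =
  [&& e \in arcs d, e.1 < e.2,
      all (fun f => (e.1 < f.1) && (f.2 < e.2)) t & is_nesting d t].
Proof.
rewrite /is_nesting sorted_endpoints_cons /=.
by rewrite -!andbA; congr andb; rewrite andbCA; congr andb; rewrite andbCA.
Qed.

Lemma is_nesting_drop j t : is_nesting d t -> is_nesting d (drop j t).
Proof.
elim: t j => [|e t IH] [|j] //=; rewrite is_nesting_cons => /and4P[_ _ _].
exact: IH.
Qed.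

(** The chain starts with the left end of the outermost arc, the smallest one. This links future
    nestings to nesting indices. *)
Lemma path_endpoints (a : 'I_n) t : is_nesting d t ->
  path ltn a (endpoints t) = all [pred e : 'I_n * 'I_n | a < e.1] t.
Proof.
case: t => [//|e t] /=; rewrite is_nesting_cons => /and4P[et lt_e lt_t nt].
apply/andP/andP => [[lt_a _]|[lt_a _]].
  split=> //; apply/allP => f ft /=.
  by have /andP[lt1 _] := allP lt_t f ft; apply: ltn_trans lt1.
split=> //; have /andP[_] : is_nesting d (e :: t) by
  rewrite is_nesting_cons et lt_e lt_t.
exact.
Qed.

Lemma size_nesting t : is_nesting d t -> size t <= n.
Proof.
move=> nt; have : uniq (map fst t).
  elim: t nt => //= e t IH; rewrite is_nesting_cons => /and4P[_ _ lt_t /IH->].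
  rewrite andbT; apply/mapP=> -[f /(allP lt_t)/andP[lt1 _] eq1].
  by rewrite eq1 ltnn in lt1.
by move/card_uniqP; rewrite size_map => <-; rewrite -[leqRHS]card_ord max_card.
Qed.

(** The maximum is attained, and dropping outer arcs from a longest nesting gives every smaller
    size; conversely a nesting has at most [n] arcs, so its size is in the range of the maximum. *)
Lemma nesting_indexP (a : 'I_n) j :
  reflect (exists t, [/\ size t = j, is_nesting d t
                       & all [pred e : 'I_n * 'I_n | a < e.1] t])
          (j <= nesting_index d a).
Proof.
apply: (iffP idP) => [|[t [<- nt at_]]].
  pose P (i : 'I_n.+1) := [exists t : i.-tuple ('I_n * 'I_n),
           is_nesting d t && all [pred e : 'I_n * 'I_n | a < e.1] t].
  have P0 : P ord0 by apply/existsP; exists [tuple].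
  rewrite /nesting_index (bigop.bigmax_eq_arg _ P0) //.
  case: arg_maxnP => // i /existsP[t /andP[nt at_]] _ le_ji.
  exists (drop (i - j) t); split.
  - by rewrite size_drop size_tuple subKn.
  - exact: is_nesting_drop.
  - by apply/allP=> e /mem_drop; apply/allP.
have le_tn : size t < n.+1 by rewrite ltnS size_nesting.
rewrite /nesting_index -[size t]/(val (Ordinal le_tn)); apply: leq_bigmax_cond.
by apply/existsP; exists (in_tuple t); rewrite nt.
Qed.

Lemma nesting_index_anti (a b : 'I_n) : a <= b ->
  nesting_index d b <= nesting_index d a.
Proof.
move=> le_ab; have /nesting_indexP[t [st nt bt]] := leqnn (nesting_index d b).
apply/nesting_indexP; exists t; split=> //; apply/allP=> e /(allP bt).
exact: leq_ltn_trans.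
Qed.

Lemma nonnestingP k :
  reflect ((forall t, is_nesting d t -> size t != k.+1) /\
           {in semiarcs d, forall a, nesting_index d a < k})
          (nonnesting k.+1 d).
Proof.
apply: (iffP andP) => [[nn nf]|[nn nf]]; split.
- move=> t nt; apply: contra nn => /eqP st; apply/existsP.
  by rewrite -st; exists (in_tuple t).
- move=> a aS; rewrite ltnNge; apply: contra nf =>
    /nesting_indexP[t [st nt at_]].
  apply/existsP; exists a; rewrite aS -st /=; apply/existsP;
    exists (in_tuple t).
  by rewrite nt path_endpoints.
- by apply/negP => /existsP[t /nn]; rewrite size_tuple eqxx.
apply/negP => /existsP[a /andP[aS /existsP[t /andP[nt]]]].
rewrite path_endpoints // => at_; have := nf a aS; rewrite ltnNge => /negP[].
by apply/nesting_indexP; exists t; rewrite size_tuple.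
Qed.

(** * Ranks of semi-arcs and entries of labels *)

Definition semiarc_rank (a : 'I_n) := #|[set b in semiarcs d | b < a]|.

Definition label_entry i := #|[set a in semiarcs d | i <= nesting_index d a]|.

Lemma label_entry0 : label_entry 0 = #|semiarcs d|.
Proof. by apply: eq_card => a; rewrite inE andbT. Qed.

Lemma label_entry_anti i j : i <= j -> label_entry j <= label_entry i.
Proof.
move=> le_ij; apply/subset_leq_card/subsetP=> a; rewrite !inE => /andP[->] /=.
exact: leq_trans.
Qed.

(* The semi-arcs of nesting index at least [i] are the leftmost ones. *)
Lemma leq_nesting_index (a : 'I_n) i : a \in semiarcs d ->
  (i <= nesting_index d a) = (semiarc_rank a < label_entry i).
Proof.
move=> aS; apply/idP/idP => [le_ia|].
  apply: proper_card; apply/properP; split.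
    apply/subsetP=> b; rewrite !inE => /andP[-> lt_ba] /=.
    by apply: leq_trans le_ia _; apply: nesting_index_anti; apply: ltnW.
  by exists a; rewrite !inE ?ltnn ?aS ?andbF.
apply: contraLR; rewrite -ltnNge -leqNgt => lt_ai.
apply/subset_leq_card/subsetP=> b; rewrite !inE => /andP[-> le_ib] /=.
rewrite ltnNge; apply: contraTN le_ib => /nesting_index_anti.
by rewrite -ltnNge => /leq_ltn_trans; apply.
Qed.

Lemma semiarc_rank_inj : {in semiarcs d &, injective semiarc_rank}.
Proof.
have mono (a b : 'I_n) : a \in semiarcs d -> a < b ->
    semiarc_rank a < semiarc_rank b.
  move=> aS lt_ab; apply: proper_card; apply/properP; split.
    by apply/subsetP=> c; rewrite !inE => /andP[-> /ltn_trans]; apply.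
  by exists a; rewrite !inE ?ltnn ?aS ?andbF.
move=> a b aS bS eq_ab; apply/val_inj.
by case: (ltngtP a b) => // [/(mono _ _ aS)|/(mono _ _ bS)]; rewrite eq_ab ltnn.
Qed.

(** Ranks are distinct and smaller than the number of semi-arcs, so they exhaust the range. *)
Lemma perm_semiarc_rank :
  perm_eq [seq semiarc_rank a | a <- enum (semiarcs d)]
          (iota 0 (label_entry 0)).
Proof.
have Uf : uniq [seq semiarc_rank a | a <- enum (semiarcs d)].
  rewrite map_inj_in_uniq ?enum_uniq // => a b; rewrite !mem_enum.
  exact: semiarc_rank_inj.
apply: uniq_perm => //; first exact: iota_uniq.
apply: (uniq_min_size Uf _ _).2 => [p /mapP[a]|].
  (* Case [i = 0] of [leq_nesting_index], whose left side is trivially true. *)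
  by rewrite mem_enum => aS ->; rewrite mem_iota /= -leq_nesting_index.
by rewrite size_iota size_map -cardE label_entry0.
Qed.

Lemma nth_label k i : i < k -> nth 0 (label k d) i = label_entry i.
Proof. exact: nth_mkseq. Qed.

End Nesting.

(** * Adding a last vertex *)

Lemma bump_ord n (i : 'I_n) : bump n i = i.
Proof. exact: lift_max. Qed.

Section Extension.
Variables (n : nat) (d : open_diagram n) (c : option 'I_n) (b : bool).
Local Notation up := (@lift n.+1 ord_max).

(* The new vertex closes the semi-arc [c], if any, and opens one if [b].  The
   requirement [x \in semiarcs d] makes the construction total: nothing is
   closed when [c = Some x] and [x] is not a semi-arc. *)
Definition ext_val : {set 'I_n.+1 * 'I_n.+1} * {set 'I_n.+1} :=
  ([set e | match unlift ord_max e.1, unlift ord_max e.2 with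
            | Some x, Some y => (x, y) \in arcs d
            | Some x, None => (c == Some x) && (x \in semiarcs d)
            | None, _ => false
            end],
   [set v | if unlift ord_max v is Some x
            then (x \in semiarcs d) && (c != Some x) else b]).

Lemma ext_subproof : is_open_diagram ext_val.
Proof.
have [ltD outD inD openD] := is_open_diagramP _ (valP d).
apply/is_open_diagramP; split=> x y => [|z|z|].
- rewrite inE /=; case: (unliftP ord_max x) => [x' ->|-> //].
  case: (unliftP ord_max y) => [y' ->|-> _]; rewrite ?lift_max ?bump_ord //.
  exact: ltD.
- rewrite !inE /=; case: (unliftP ord_max x) => [x' _|//].
  case: (unliftP ord_max y) => [y' ->|->]; case: (unliftP ord_max z) =>
    [z' ->|->] //.
  + by move=> D1 D2; rewrite (outD _ _ _ D1 D2).
  (* An old arc leaves [x'] and the new arc closes a semi-arc at [x']: impossible in [d]. *)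
  + by move=> /openD/negP ? /andP[].
  + by move=> /andP[_ ?] /openD/negP.
- rewrite !inE /=; case: (unliftP ord_max z) => [z' _|_].
    case: (unliftP ord_max x) => [x' ->|->]; case: (unliftP ord_max y) =>
      [y' ->|->] //.
    by move=> D1 D2; rewrite (inD _ _ _ D1 D2).
  case: (unliftP ord_max x) => [x' ->|->]; case: (unliftP ord_max y) =>
    [y' ->|->] //.
  by move=> /andP[/eqP-> _] /andP[/eqP[->] _].
- rewrite !inE /=; case: (unliftP ord_max x) => [x' _|//].
  case: (unliftP ord_max y) => [y' _ /openD/negbTE-> //|_ /andP[-> _]].
  by rewrite andbF.
Qed.

Definition ext : open_diagram n.+1 := OpenDiagram ext_subproof.

Lemma arcs_ext_up x y : ((up x, up y) \in arcs ext) = ((x, y) \in arcs d).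
Proof. by rewrite inE /= !liftK. Qed.

Lemma arcs_ext_max x :
  ((up x, ord_max) \in arcs ext) = (c == Some x) && (x \in semiarcs d).
Proof. by rewrite inE /= liftK unlift_none. Qed.

Lemma arcs_ext_maxl v : ((ord_max, v) \in arcs ext) = false.
Proof. by rewrite inE /= unlift_none. Qed.

Lemma semiarcs_ext_up x :
  (up x \in semiarcs ext) = (x \in semiarcs d) && (c != Some x).
Proof. by rewrite inE liftK. Qed.

Lemma semiarcs_ext_max : (ord_max \in semiarcs ext) = b.
Proof. by rewrite inE unlift_none. Qed.

Definition up_arc (e : 'I_n * 'I_n) := (up e.1, up e.2).

Lemma nesting_ext_up t : is_nesting ext (map up_arc t) = is_nesting d t.
Proof.
elim: t => //= e t IH;
  rewrite !is_nesting_cons IH arcs_ext_up ?lift_max ?bump_ord all_map.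
rewrite -surjective_pairing; congr [&& _, _, _ & _].
by apply: eq_all => f /=; rewrite ?lift_max ?bump_ord.
Qed.

Lemma nesting_ext_max x t :
  is_nesting ext ((up x, ord_max) :: map up_arc t) =
  [&& c == Some x, x \in semiarcs d, is_nesting d t
    & all [pred e : 'I_n * 'I_n | x < e.1] t].
Proof.
rewrite is_nesting_cons arcs_ext_max nesting_ext_up /= bump_ord ltn_ord /=
  all_map.
rewrite -andbA; congr [&& _, _ & _]; rewrite andbC; congr andb.
by apply: eq_all => e /=; rewrite ?lift_max ?bump_ord ltn_ord andbT.
Qed.

(** Only the outermost arc can end at the new vertex, because right ends strictly decrease inwards
    and no vertex lies beyond the last one. *)
Lemma nesting_extP t :
  is_nesting ext t ->
  exists s, [\/ t = map up_arc s |
             exists2 x, c = Some x & t = (up x, ord_max) :: map up_arc s].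
Proof.
elim: t => [|[u v] t IH]; first by exists [::]; left.
rewrite is_nesting_cons /= => /and4P[uvA _ lt_t /IH[s ts]].
case: (unliftP ord_max u) uvA => [x ->|->]; last by rewrite arcs_ext_maxl.
case: (unliftP ord_max v) lt_t => [y ->|->] lt_t.
  rewrite arcs_ext_up => xyA.
  case: ts => [->|[z _ def_t]]; first by exists ((x, y) :: s); left.
  move: lt_t; rewrite def_t /= !bump_ord => /andP[/andP[_]].
  by rewrite ltnNge ltnW ?ltn_ord.
rewrite arcs_ext_max => /andP[/eqP cx _].
case: ts => [->|[z _ def_t]]; first by exists s; right; exists x.
by move: lt_t; rewrite def_t /= ltnn andbF.
Qed.

Lemma nesting_index_ext_max : nesting_index ext ord_max = 0.
Proof.
apply/eqP; rewrite -leqn0 leqNgt; apply/negP=>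
  /nesting_indexP[[|e t] [] //= _ _].
by rewrite ltnNge -ltnS ltn_ord.
Qed.

(** A nesting to the right of [x] is either old or consists of the new arc around an old nesting to
    the right of [a]. The disjunction of inequalities expresses a maximum. *)
Lemma nesting_index_ext_up (x : 'I_n) j :
  (j <= nesting_index ext (up x)) =
  (j <= nesting_index d x) ||
  (if c is Some a
   then [&& a \in semiarcs d, x < a & j <= (nesting_index d a).+1] else false).
Proof.
have all_up (s : seq ('I_n * 'I_n)) :
    all [pred e : 'I_n.+1 * 'I_n.+1 | up x < e.1] (map up_arc s) =
    all [pred e : 'I_n * 'I_n | x < e.1] s.
  by rewrite all_map; apply: eq_all => e /=; rewrite ?lift_max ?bump_ord.
apply/idP/idP => [/nesting_indexP[t [<- nt lt_t]]|].
  have [s [def_t|[a ca def_t]]] := nesting_extP nt.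
    apply/orP; left; apply/nesting_indexP; exists s.
    by rewrite def_t size_map -nesting_ext_up -all_up -def_t.
  rewrite def_t nesting_ext_max in nt; have /and4P[_ aS ns lt_s] := nt.
  move: lt_t; rewrite def_t /= ?lift_max ?bump_ord => /andP[lt_xa _].
  apply/orP; right; rewrite ca aS lt_xa size_map /= ltnS.
  by apply/nesting_indexP; exists s.
case/orP=> [/nesting_indexP[s [<- ns lt_s]]|].
  by apply/nesting_indexP; exists (map up_arc s);
    rewrite size_map nesting_ext_up all_up.
case ca: c => [a|//] /and3P[aS lt_xa]; case: j =>
  // j /nesting_indexP[s [<- ns lt_s]].
apply/nesting_indexP; exists ((up a, ord_max) :: map up_arc s); split.
- by rewrite /= size_map.
- by rewrite nesting_ext_max ca eqxx aS ns lt_s.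
- apply/andP; split; first by rewrite /= !bump_ord.
  rewrite -[_ (map _ _)]/(all _ _) all_map; apply/allP=> e /(allP lt_s) /=.
  by rewrite !bump_ord; apply: ltn_trans.
Qed.

End Extension.

(** * Effect of an extension on labels and on nonnesting *)

Lemma card_ordS_set n (P : pred 'I_n.+1) :
  #|[set v | P v]| = #|[set x | P (lift ord_max x)]| + P ord_max.
Proof.
rewrite -!sum1dep_card big_mkcond big_ord_recr /= -big_mkcond.
have -> : (if P ord_max then 1 else 0) = P ord_max by case: (P ord_max).
congr (_ + _); apply: eq_bigl => x; congr (P _); apply/val_inj.
by rewrite /= bump_ord.
Qed.

(* The label obtained from [s] by closing the semi-arc that has [p] semi-arcs
   on its left; the case [i = 0] is always the first one, as [p < s_0]. *)
Definition closed_label k (b : bool) (s : seq nat) (p : nat) : seq nat :=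
  mkseq (fun i => if p < nth 0 s i then (nth 0 s i).-1 + (b && (i == 0))
                  else if p < nth 0 s i.-1 then p else nth 0 s i) k.

(** Excludes the values of [c] on which [ext] closes nothing and agrees with [None]; this makes
    [ext] injective. *)
Definition may_close n (d : open_diagram n) (c : option 'I_n) : bool :=
  if c is Some a then a \in semiarcs d else true.

Section Successors.
Variables (k n : nat) (d : open_diagram n).
Implicit Types (c : option 'I_n) (b : bool).
Hypothesis k_gt0 : 0 < k.

Lemma label_entry_ext c b i :
  label_entry (ext d c b) i =
  #|[set x | [&& x \in semiarcs d, c != Some x
               & i <= nesting_index (ext d c b) (lift ord_max x)]]|
  + (b && (i == 0)).
Proof.
rewrite /label_entry card_ordS_set semiarcs_ext_max nesting_index_ext_max leqn0.
by congr (_ + _); apply: eq_card => x; rewrite !inE liftK andbA.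
Qed.

Lemma label_ext_None b :
  label k (ext d None b) = mkseq (fun i => label_entry d i + (b && (i == 0))) k.
Proof.
apply: eq_map => i; rewrite -/(label_entry _ _) label_entry_ext; congr (_ + _).
by apply: eq_card => x; rewrite !inE nesting_index_ext_up orbF.
Qed.

(** Let [m] be the index of [a]. Apart from a newly opened semi-arc, entries up to [m] lose just
    [a], entry [m + 1] counts precisely the semi-arcs left of [a], and later entries do not
    change. *)
Lemma label_entry_ext_Some a b i : a \in semiarcs d ->
  label_entry (ext d (Some a) b) i =
  if semiarc_rank d a < label_entry d i
  then (label_entry d i).-1 + (b && (i == 0))
  else if semiarc_rank d a < label_entry d i.-1 then semiarc_rank d a
  else label_entry d i.
Proof.
move=> aS; rewrite label_entry_ext.
pose m := nesting_index d a.
have below (x : 'I_n) : x < a -> m <= nesting_index d x.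
  by move=> /ltnW; apply: nesting_index_anti.
have above (x : 'I_n) : a <= x -> nesting_index d x <= m.
  exact: nesting_index_anti.
rewrite -!leq_nesting_index // -/m.
case: (leqP i m) => [le_im|lt_mi].
  congr (_ + _); rewrite /label_entry [in RHS](cardsD1 a) inE aS -/m le_im /=.
  apply: eq_card => x; rewrite !inE nesting_index_ext_up aS /= eq_sym.
  rewrite (inj_eq (@Some_inj _)) andbCA; congr [&& _, _ & _].
  case: (ltnP x a) => [/below le_mx|_]; last by rewrite orbF.
  by rewrite (leq_trans le_im le_mx).
have -> : (i == 0) = false by case: i lt_mi.
rewrite andbF addn0; case: (leqP i.-1 m) => [le_im|lt_mi'].
  (* Left of [a] every index is now at least [m + 1], right of it still at most [m]. *)
  have i_def : i = m.+1 by lia.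
  apply: eq_card => x; rewrite !inE nesting_index_ext_up aS /=; congr andb.
  rewrite -/m i_def leqnn andbT (inj_eq (@Some_inj _)).
  case: (ltngtP x a) => [lt_xa|lt_ax|/val_inj->];
    rewrite ?orbT ?eqxx ?andbF ?orbF //.
    by rewrite andbT; apply: contraTneq lt_xa => ->; rewrite ltnn.
  by rewrite [_ < nesting_index _ _]ltnNge above ?andbF // ltnW.
(* The new arc lifts indices only up to [m + 1 < i], and [a] was not counted at [i] before. *)
apply: eq_card => x; rewrite !inE nesting_index_ext_up aS /=; congr andb.
rewrite (inj_eq (@Some_inj _)) -/m [i <= m.+1]leqNgt.
have -> : m.+1 < i by case: i lt_mi lt_mi'.
rewrite andbF orbF; case: eqP => [<-|//] /=.
by rewrite leqNgt lt_mi.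
Qed.

Lemma label_ext_Some a b : a \in semiarcs d ->
  label k (ext d (Some a) b) = closed_label k b (label k d) (semiarc_rank d a).
Proof.
move=> aS; apply: (@eq_from_nth _ 0); rewrite !size_mkseq // => i lt_ik.
rewrite nth_label // label_entry_ext_Some // nth_mkseq // !nth_label //.
exact: leq_ltn_trans (leq_pred _) lt_ik.
Qed.

(* Closing a semi-arc of maximal nesting index [k-1] creates a future
   [k+1]-nesting unless no semi-arc is left of it. *)
Definition closable (a : 'I_n) : bool :=
  (a \in semiarcs d) &&
  ((nth 0 (label k d) k.-1 <= semiarc_rank d a) || (semiarc_rank d a == 0)).

Definition admissible c : bool := if c is Some a then closable a else true.

(** Extending destroys no nesting. The new arc surrounds fewer than [k] nested arcs when [d] is
    nonnesting; but a semi-arc left of [a] reaches at least one more than the index of [a], and this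
    must stay below [k]. *)
Lemma ext_Pi c b : may_close d c ->
  (ext d c b \in Pi k n.+1) = (d \in Pi k n) && admissible c.
Proof.
move=> cS; rewrite !inE; apply/nonnestingP/andP => [[nn nf]|].
  have dPi : nonnesting k.+1 d.
    apply/nonnestingP; split=> [t nt|a aS].
      by rewrite -(size_map (@up_arc n)) nn // nesting_ext_up.
    rewrite ltnNge; apply/negP=> le_ka.
    (* If [a] itself is closed, the new arc completes a nesting of [k + 1] arcs; otherwise [a] stays
       a semi-arc of too large index. *)
    case: (c =P Some a) => [ca|/eqP ca].
      have /nesting_indexP[t [st nt lt_t]] := le_ka.
      have := nn ((lift ord_max a, ord_max) :: map (@up_arc n) t).
      rewrite nesting_ext_max ca eqxx aS nt lt_t /= size_map st eqxx.
      by move/(_ isT).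
    have := nf (lift ord_max a); rewrite semiarcs_ext_up aS ca => /(_ isT).
    by rewrite ltnNge nesting_index_ext_up le_ka.
  split=> //; case: c cS nf {nn} => [a|//] /= aS nf; rewrite /= /closable aS /=.
  rewrite nth_label ?prednK // leqNgt -leq_nesting_index // -implybE.
  (* Any semi-arc [x] left of [a] would get index at least [k]. *)
  apply/implyP=> le_ka; rewrite cards_eq0; apply/eqP/setP=> x; rewrite !inE.
  apply/negP=> /andP[xS lt_xa]; have := nf (lift ord_max x).
  rewrite semiarcs_ext_up xS (inj_eq (@Some_inj _)) /=.
  have -> : a != x by apply: contraTneq lt_xa => ->; rewrite ltnn.
  move/(_ isT); rewrite ltnNge nesting_index_ext_up aS lt_xa /=.
  by rewrite -[X in X <= _.+1](prednK k_gt0) ltnS le_ka orbT.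
case=> /nonnestingP[nn nf] cA; split=> [t nt|v].
  have [s [def_t|[a ca def_t]]] := nesting_extP nt.
    by rewrite def_t size_map nn // -(nesting_ext_up d c b) -def_t.
  move: nt; rewrite def_t nesting_ext_max => /and4P[_ aS ns lt_s].
  rewrite /= size_map eqSS neq_ltn; apply/orP; left.
  by apply: leq_ltn_trans (nf a aS); apply/nesting_indexP; exists s.
case: (unliftP ord_max v) => [x ->|->]; last by rewrite nesting_index_ext_max.
rewrite semiarcs_ext_up => /andP[xS cx].
rewrite ltnNge nesting_index_ext_up negb_or -ltnNge nf //=.
case: c cS cA cx {nn} => [a|//] /= aS /andP[_ cA] cx; rewrite aS /=.
apply/negP=> /andP[lt_xa le_ka]; case/orP: cA => [|].
  rewrite nth_label ?prednK // leqNgt -leq_nesting_index //.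
  by rewrite -ltnS prednK // le_ka.
rewrite cards_eq0 => /eqP/setP/(_ x); by rewrite !inE xS lt_xa.
Qed.

(** Opening choices come first, so that the labels appear in the order of the list in
    [perm_rule]. *)
Definition choices : seq (option 'I_n * bool) :=
  [seq (c, b) | b <- [:: true; false],
                c <- None :: map Some [seq a <- enum 'I_n | closable a]].

Lemma mem_choices c b : ((c, b) \in choices) = admissible c.
Proof.
apply/allpairsP/idP => [[[b' c'] /= [_ + [-> _]]]|cA].
  rewrite inE => /predU1P[->//|/mapP[a]]; rewrite mem_filter => /andP[aC _] ->.
  exact: aC.
exists (b, c); split=> //=; first by case: b.
case: c cA => //= a aC; rewrite inE (mem_map (@Some_inj _)) mem_filter aC.
by rewrite mem_enum.
Qed.

Lemma choices_uniq : uniq choices.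
Proof.
apply: allpairs_uniq => //.
  have U : uniq [seq a <- enum 'I_n | closable a] by
    apply/filter_uniq/enum_uniq.
  rewrite cons_uniq (map_inj_uniq (@Some_inj _)) U andbT.
  by apply/mapP=> -[].
by move=> [? ?] [? ?] _ _ [-> ->].
Qed.

End Successors.

(** * Unique decomposition of a diagram by its last vertex *)

Lemma ext_inj n (d1 d2 : open_diagram n) c1 c2 b1 b2 :
  may_close d1 c1 -> may_close d2 c2 ->
  ext d1 c1 b1 = ext d2 c2 b2 -> [/\ d1 = d2, c1 = c2 & b1 = b2].
Proof.
move=> c1S c2S eq_ext.
have eqA : arcs d1 = arcs d2.
  by apply/setP=> -[x y]; rewrite -(arcs_ext_up d1 c1 b1) eq_ext arcs_ext_up.
have c_eq x : (c1 == Some x) && (x \in semiarcs d1) =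
              (c2 == Some x) && (x \in semiarcs d2).
  by rewrite -(arcs_ext_max d1 c1 b1) eq_ext arcs_ext_max.
have s_eq x : (x \in semiarcs d1) && (c1 != Some x) =
              (x \in semiarcs d2) && (c2 != Some x).
  by rewrite -(semiarcs_ext_up d1 c1 b1) eq_ext semiarcs_ext_up.
(* A semi-arc of the smaller diagram either survives or is the left end of the new arc. *)
have eqS : semiarcs d1 = semiarcs d2.
  apply/setP=> x; move: (c_eq x) (s_eq x).
  by case: (_ == _) (_ == _) (_ \in _) (_ \in _) => [] [] [] [].
split.
- by apply/val_inj/injective_projections.
- case: c1 c_eq c1S {s_eq eq_ext} => [a|] c_eq /= c1S.
    by move: (c_eq a); rewrite eqxx c1S => /esym/andP[/eqP].
  by case: c2 c_eq c2S => [a|//] /(_ a); rewrite eqxx /= => <-.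
by rewrite -(semiarcs_ext_max d1 c1 b1) eq_ext semiarcs_ext_max.
Qed.

(** Deletes the last vertex, turning the arc that ends there, if any, back into a semi-arc. *)
Lemma ext_surj n (D : open_diagram n.+1) : exists d c b,
  may_close d c /\ D = ext d c b.
Proof.
pose up := @lift n.+1 ord_max.
pose val_d := ([set e | (up e.1, up e.2) \in arcs D],
  [set x | (up x \in semiarcs D) || ((up x, ord_max) \in arcs D)]).
have [ltD outD inD openD] := is_open_diagramP _ (valP D).
have max_arcs v : (ord_max, v) \in arcs D = false.
  by apply/negP=> /ltD; rewrite ltnNge -ltnS ltn_ord.
have open_d : is_open_diagram val_d.
  apply/is_open_diagramP; split=> x y => [|z|z|]; rewrite !inE /=.
  - by move/ltD; rewrite !lift_max.
  - by move=> D1 D2; apply: lift_inj (outD _ _ _ D1 D2).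
  - by move=> D1 D2; apply: lift_inj (inD _ _ _ D1 D2).
  move=> xyD; rewrite negb_or (openD _ _ xyD) /=; apply/negP =>
    /(outD _ _ _ xyD).
  by move/eqP; rewrite eq_sym (negbTE (neq_lift _ _)).
(* At most one arc ends at the last vertex, so the choice is forced. *)
pose c := [pick x | (up x, ord_max) \in arcs D].
have cE x : (c == Some x) = ((up x, ord_max) \in arcs D).
  rewrite /c; case: pickP => [y yD|/(_ x)->//]; apply/eqP/idP => [[<-]//|xD].
  by congr Some; apply: lift_inj (inD _ _ _ yD xD).
exists (OpenDiagram open_d), c, (ord_max \in semiarcs D); split.
  by rewrite /may_close; case def_c: c => [a|//];
    rewrite inE -cE def_c eqxx orbT.
apply/val_inj/injective_projections; apply/setP.
  move=> [u v]; rewrite [in RHS]inE /=.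
  case: (unliftP ord_max u) => [x ->|->]; last exact: max_arcs.
  case: (unliftP ord_max v) => [y ->|->]; first by rewrite inE.
  rewrite cE inE -[LHS]/((up x, ord_max) \in arcs D).
  by case: ((up x, ord_max) \in arcs D); rewrite ?orbT.
move=> v; rewrite [in RHS]inE; case: (unliftP ord_max v) => [x ->|-> //].
rewrite inE cE -[LHS]/(up x \in semiarcs D).
case: (boolP ((up x, ord_max) \in arcs D)) => [/openD/negbTE-> //|_].
by rewrite orbF andbT.
Qed.

(** * The succession rule *)

Section Rule.
Variables (k : nat) (s : seq nat).
Hypotheses (k_gt0 : 0 < k) (size_s : size s = k).
Hypothesis s_anti : forall i j, i <= j -> nth 0 s j <= nth 0 s i.

(** For a vertex that closes without opening: by monotonicity the entries before [j] exceed [i] and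
    those from [j] on are at most [i]. So [closed_label] decrements the former, puts [i] at [j] and
    keeps the rest. *)
Lemma rule_closer j i : 0 < j < k -> nth 0 s j <= i < nth 0 s j.-1 ->
  map predn (take j s) ++ i :: drop j.+1 s = closed_label k false s i.
Proof.
move=> /andP[j_gt0 lt_jk] /andP[le_ji lt_ij].
have size_take_s : size (take j s) = j by rewrite size_take size_s lt_jk.
apply: (@eq_from_nth _ 0).
  by rewrite size_cat size_map size_take_s /= size_drop size_s size_mkseq addnS
    -addSn subnKC.
move=> l; rewrite size_cat size_map size_take_s /= size_drop size_s addnS
  -addSn subnKC // => lt_lk.
rewrite nth_mkseq // nth_cat size_map size_take_s addn0.
case: (ltnP l j) => [lt_lj|le_jl].
  rewrite (nth_map 0) ?size_take_s // nth_take //.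
  by rewrite (leq_trans lt_ij) // s_anti // -ltnS prednK.
rewrite ltnNge (leq_trans _ le_ji) ?s_anti //=.
case: (ltngtP j l) le_jl => // [lt_jl|<-] _; last by rewrite subnn /= lt_ij.
rewrite -[l - j]prednK ?subn_gt0 //= nth_drop.
rewrite ltnNge (leq_trans _ le_ji) ?s_anti //=;
  last by rewrite -ltnS prednK // (leq_trans _ lt_jl).
by congr (nth 0 s _); lia.
Qed.

(** For a vertex that closes and opens: compared with [rule_closer] only the first entry differs. It
    exceeds [i], so it was decremented, and opening restores it. *)
Lemma rule_transitory j i : 0 < j < k -> nth 0 s j <= i < nth 0 s j.-1 ->
  nth 0 s 0 :: map predn (take j.-1 (behead s)) ++ i :: drop j.+1 s =
  closed_label k true s i.
Proof.
move=> jk ji; have s0_gt : i < nth 0 s 0.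
  by case/andP: ji => _ /leq_trans; apply; apply: s_anti.
have := rule_closer jk ji; rewrite /closed_label.
have [j_gt0 _] := andP jk; rewrite -(prednK j_gt0).
case: s size_s s0_gt => [|s0 s'] size_s' /= s0_gt.
  by move: k_gt0; rewrite -size_s'.
rewrite -size_s' /mkseq /= s0_gt /= => -[_ ->]; rewrite addn1 (ltn_predK s0_gt).
congr (_ :: _); apply/eq_in_map => l; rewrite mem_iota => /andP[l_gt0 _].
by case: l l_gt0.
Qed.

(** Closing the leftmost semi-arc when its index is [k - 1]: all entries are at least the last one,
    hence positive, and all drop before the opening is counted. *)
Lemma rule_last b : 0 < nth 0 s k.-1 ->
  (if b then nth 0 s 0 :: map predn (behead s) else map predn s) =
  closed_label k b s 0.
Proof.
move=> s_gt0; have gt0 l : l < k -> 0 < nth 0 s l.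
  by move=> lt_lk; apply: leq_trans s_gt0 (s_anti _); rewrite -ltnS prednK.
have -> : map predn s = closed_label k false s 0.
  apply: (@eq_from_nth _ 0); rewrite size_map ?size_mkseq // size_s => l lt_lk.
  by rewrite nth_mkseq // (nth_map 0) ?size_s // gt0 ?addn0.
case: b => //; rewrite /closed_label.
case: s size_s gt0 => [|s0 s'] size_s' gt0 /=.
  by move: k_gt0; rewrite -size_s'.
rewrite -size_s' in gt0 *; rewrite /mkseq /= (gt0 0) //= addn1 prednK;
  last exact: (gt0 0).
congr (_ :: _).
apply: (@eq_from_nth _ 0); rewrite size_map ?size_map ?size_iota // => l lt_lk.
rewrite (nth_map 0) // (nth_map 0) ?size_iota // nth_iota //=.
by have /= -> := gt0 l.+1 lt_lk; rewrite addn0.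
Qed.

(** Consecutive intervals abut, so they tile the whole range without overlap. *)
Lemma perm_flatten_index_iota m :
  perm_eq (flatten [seq index_iota (nth 0 s j) (nth 0 s j.-1) | j <- iota 1 m])
          (index_iota (nth 0 s m) (nth 0 s 0)).
Proof.
elim: m => [|m IH]; first by rewrite /index_iota subnn.
rewrite -[m.+1]addn1 iotaD map_cat flatten_cat /= cats0 add1n /= perm_catC
  addn1.
rewrite -(perm_cat2l (index_iota (nth 0 s m.+1) (nth 0 s m))) in IH.
apply: perm_trans IH _.
rewrite /index_iota -{2}(subnKC (s_anti (leqnSn m))) -iotaD.
by rewrite addnC addnBA ?s_anti // subnK ?s_anti.
Qed.

(** Ranks between the last and first entries account for the families indexed by [j] and [i]. The
    extra rank 0, present when the last entry is positive, accounts for the final pair of labels. *)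
Lemma perm_rule (ranks : seq nat) :
  perm_eq ranks (index_iota (nth 0 s k.-1) (nth 0 s 0)
                 ++ (if 0 < nth 0 s k.-1 then [:: 0] else [::])) ->
  perm_eq (((nth 0 s 0).+1 :: behead s) :: map (closed_label k true s) ranks
           ++ s :: map (closed_label k false s) ranks)
          (succession_rule k s).
Proof.
move=> perm_ranks.
pose P := flatten [seq index_iota (nth 0 s j) (nth 0 s j.-1)
                   | j <- iota 1 k.-1].
have {}perm_ranks :
    perm_eq ranks (P ++ (if 0 < nth 0 s k.-1 then [:: 0] else [::])).
  apply: perm_trans perm_ranks _; rewrite perm_cat2r perm_sym.
  exact: perm_flatten_index_iota.
have rule_map b (F : nat -> nat -> seq nat) :
    (forall j i, 0 < j < k -> nth 0 s j <= i < nth 0 s j.-1 ->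
       F j i = closed_label k b s i) ->
    [seq F j i | j <- iota 1 k.-1, i <- index_iota (nth 0 s j) (nth 0 s j.-1)]
    = map (closed_label k b s) P.
  move=> eqF; rewrite map_flatten -map_comp; congr flatten; apply/eq_in_map=> j.
  rewrite mem_iota add1n prednK // => jk /=; apply/eq_in_map=> i.
  by rewrite mem_index_iota; apply: eqF.
rewrite /succession_rule (rule_map true _ rule_transitory).
rewrite (rule_map false _ rule_closer).
have perm_b b := perm_map (closed_label k b s) perm_ranks.
apply/permP=> q; have /permP/(_ q) := perm_b true;
  have /permP/(_ q) := perm_b false.
case: ifP => [s_gt0|_]; rewrite !map_cat !count_cat /= !count_cat /=;
  last by lia.
by rewrite (rule_last true s_gt0) (rule_last false s_gt0); lia.
Qed.

End Rule.

(** * Comparison with the tree, level by level *)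

Section Tree.
Variable k : nat.
Hypothesis k_gt0 : 0 < k.

Lemma nth_label_anti n (d : open_diagram n) i j : i <= j ->
  nth 0 (label k d) j <= nth 0 (label k d) i.
Proof.
move=> le_ij; case: (ltnP j k) => [lt_jk|le_kj].
  by rewrite !nth_label ?label_entry_anti // (leq_ltn_trans le_ij).
(* From [k] on, the default value 0 is below everything. *)
by rewrite nth_default // size_mkseq.
Qed.

(** A closable rank [p] satisfies [p < s_0] and either [s_(k-1) <= p] or [p = 0]; rank 0 contributes
    outside the interval exactly when [s_(k-1) > 0]. *)
Lemma perm_closable_rank n (d : open_diagram n) :
  perm_eq [seq semiarc_rank d a | a <- enum 'I_n & closable k d a]
          (index_iota (nth 0 (label k d) k.-1) (nth 0 (label k d) 0)
           ++ (if 0 < nth 0 (label k d) k.-1 then [:: 0] else [::])).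
Proof.
set s := label k d.
pose Q p := (nth 0 s k.-1 <= p) || (p == 0).
have -> : [seq a <- enum 'I_n | closable k d a] =
          [seq a <- enum (semiarcs d) | Q (semiarc_rank d a)].
  have -> : enum (semiarcs d) = [seq a <- enum 'I_n | a \in semiarcs d].
    by rewrite enumT.
  rewrite -[RHS]filter_predI; apply: eq_filter => a.
  by rewrite /closable /= andbC.
rewrite -filter_map; apply: perm_trans (perm_filter _ (perm_semiarc_rank d)) _.
rewrite -(nth_label d k_gt0) -/s.
(* Guarantees that rank 0 occurs once the last entry is positive. *)
have s_anti : nth 0 s k.-1 <= nth 0 s 0 by apply: nth_label_anti.
apply: uniq_perm; first by rewrite filter_uniq ?iota_uniq.
  rewrite cat_uniq iota_uniq; case: ifP => //= s_gt0; rewrite mem_index_iota.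
  by rewrite leqNgt s_gt0.
move=> p; rewrite mem_filter mem_cat mem_iota mem_index_iota /Q add0n /=.
case: ifP => s_gt0; rewrite ?inE ?in_nil; lia.
Qed.

Lemma perm_label_choices n (d : open_diagram n) :
  perm_eq [seq label k (ext d cb.1 cb.2) | cb <- choices k d]
          (succession_rule k (label k d)).
Proof.
have size_s : size (label k d) = k by rewrite size_mkseq.
apply: perm_trans (perm_rule k_gt0 size_s (@nth_label_anti n d)
  (perm_closable_rank d)).
rewrite /choices /= cats0 map_cat /= -!map_comp.
set A := [seq a <- _ | _].
have eqF b : [seq label k (ext d (Some a) b) | a <- A] =
    [seq closed_label k b (label k d) (semiarc_rank d a) | a <- A].
  apply/eq_in_map => a; rewrite mem_filter => /andP[/andP[aS _] _].
  exact: label_ext_Some.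
rewrite /comp /= !eqF !label_ext_None.
have -> : mkseq (fun i => label_entry d i + (false && (i == 0))) k = label k d.
  by apply: eq_map => i; rewrite addn0.
suff -> : mkseq (fun i => label_entry d i + (true && (i == 0))) k =
          (nth 0 (label k d) 0).+1 :: behead (label k d) by [].
rewrite /label -(prednK k_gt0) /mkseq /= addn1; congr (_ :: _).
by apply/eq_in_map=> i; rewrite mem_iota => /andP[i_gt0 _];
  case: i i_gt0 => // i _; rewrite addn0.
Qed.

Lemma perm_flatten_map (T1 T2 : eqType) (f g : T1 -> seq T2) (s : seq T1) :
  (forall x, perm_eq (f x) (g x)) ->
  perm_eq (flatten (map f s)) (flatten (map g s)).
Proof. by move=> fg; elim: s => //= x s IH; apply: perm_cat. Qed.

(** Injectivity of [ext] across different [d] excludes repetitions; surjectivity and [ext_Pi] match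
    the members. *)
Lemma perm_Pi_succ n :
  perm_eq (enum (Pi k n.+1))
          [seq ext d cb.1 cb.2 | d <- enum (Pi k n), cb <- choices k d].
Proof.
have open_adm m (d : open_diagram m) c : admissible k d c -> may_close d c.
  by case: c => //= a /andP[].
apply: uniq_perm; first exact: enum_uniq.
  apply: allpairs_uniq_dep => [|d _|]; [exact: enum_uniq|exact: choices_uniq|].
  move=> _ _ /allpairsPdep[d1 [[c1 b1] [_ c1P ->]]]
    /allpairsPdep[d2 [[c2 b2] [_ c2P ->]]] /=.
  rewrite !mem_choices in c1P c2P.
  by case/(ext_inj (open_adm _ _ _ c1P) (open_adm _ _ _ c2P)) => -> -> ->.
move=> D; rewrite mem_enum; apply/idP/allpairsPdep => [|[d [[c b] [dP cP ->]]]].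
  have [d [c [b [cS ->]]]] := ext_surj D.
  rewrite (ext_Pi k_gt0) // => /andP[dP cA]; exists d, (c, b).
  by rewrite mem_enum mem_choices.
rewrite mem_enum mem_choices in dP cP.
by rewrite (ext_Pi k_gt0) ?dP //; apply: open_adm cP.
Qed.

(** The extensions of a diagram carry the labels that the rule assigns to its own label, so
    agreement up to order passes from one level to the next. *)
Lemma perm_label_tree n :
  perm_eq [seq label k d | d <- enum (Pi k n)]
          (tree_level (succession_rule k) (nseq k 0) n).
Proof.
elim: n => [|n IH] /=; last first.
  apply: perm_trans (perm_flatten (perm_map _ IH)).
  rewrite -map_comp; apply: perm_trans (perm_map _ (perm_Pi_succ n)) _.
  rewrite map_flatten -map_comp; apply: perm_flatten_map => d /=.
  by rewrite -map_comp; apply: perm_label_choices.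
(* In size 0 the empty diagram is the only one, and its label entries all vanish. *)
have open0 : is_open_diagram (set0, set0 : {set 'I_0}).
  by apply/is_open_diagramP; split=> -[].
have all0 (d : open_diagram 0) : d = OpenDiagram open0.
  by apply/val_inj/injective_projections; apply/setP=> -[] [].
have -> : Pi k 0 = [set OpenDiagram open0].
  apply/setP=> d; rewrite !inE [d]all0 eqxx; apply/nonnestingP.
  by split=> [[|[[]]]|[]].
rewrite enum_set1 /=; suff -> : label k (OpenDiagram open0) = nseq k 0 by [].
apply: (@eq_from_nth _ 0) => [|i]; rewrite size_mkseq ?size_nseq // => lt_ik.
rewrite nth_label // nth_nseq lt_ik; apply: eq_card0; by case.
Qed.

End Tree.

Theorem theorem5 (k : nat) (hk : 1 <= k) (n : nat) :
  #|Pi k n| = size (tree_level (succession_rule k) (nseq k 0) n).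
Proof. by rewrite -(perm_size (perm_label_tree hk n)) size_map -cardE. Qed.
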